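(* Let $X$ be a space and $G$ a connected topological group, or, alternately, let $X$ be a compact space and $G$ a connected homotopy-associative CW H-space. Then $$\mathrm{Hnil}(F(X,G)_\circ)=\mathrm{Hnil}(G).$$
   Context: All spaces have nondegenerate basepoints (the identity, for H-spaces and groups). $F(X,G)$ is the space of continuous maps $X\to G$ with the compactly generated topology and the pointwise multiplication induced from $G$; $F(X,G)_\circ$ is the path component of the constant map to the identity. An H-space is a based space $G$ with a continuous multiplication $\mu\colon G\times G\to G$ such that the restrictions of $\mu$ to $\{e\}\times G$ and $G\times\{e\}$ are homotopic to the identity, $e$ being the basepoint; a CW H-space is one that is a CW complex. $(G,\mu)$ is group-like if $\mu$ is homotopy-associative and there is a homotopy inverse $\nu\colon G\to G$, i.e. $\mu\circ(\nu\times1)\circ\Delta$ and $\mu\circ(1\times\nu)\circ\Delta$ are null-homotopic. Under either hypothesis both $G$ and $F(X,G)_\circ$ are group-like. For a group-like space $(G,\mu)$ let $\varphi_1=\mathrm{id}_G$, $\varphi_2(g_1,g_2)=\mu(\mu(g_1,g_2),\mu(\nu(g_1),\nu(g_2)))$, and $\varphi_n=\varphi_2\circ(\varphi_{n-1}\times\varphi_1)\colon G^n\to G$ for $n>1$. The homotopical nilpotency $\mathrm{Hnil}(G)$ is the least integer $n$ such that $\varphi_{n+1}$ is null-homotopic ($\infty$ if there is none). *)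

(* Defs.v *)
From HB Require Import structures.
From mathcomp Require Import all_boot all_order all_algebra.
From mathcomp Require Import all_classical all_reals all_analysis.
From mathcomp Require Import homotopy.

Set Implicit Arguments.
Unset Strict Implicit.
Unset Printing Implicit Defensive.

Import Order.TTheory GRing.Theory Num.Theory.
Import numFieldNormedType.Exports.

Local Open Scope classical_set_scope.
Local Open Scope ring_scope.

(* Everything takes place in Steenrod's category of compactly generated
   Hausdorff spaces: products, function spaces and subspaces carry the compactly
   generated topology associated with the ordinary one. *)

Section KOpen.
Variable T : topologicalType.

(* For Hausdorff T this is dual to: a set is closed iff it meets every compact
   set in a closed set. *)
Definition k_open (A : set T) : Prop :=
  forall C : set T, compact C -> open (A : set (subspace C)).

Lemma k_openT : k_open setT.
Proof. by move=> C _; exact: openT. Qed.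

Lemma k_openI : setI_closed k_open.
Proof. by move=> A B kA kB C cC; apply: openI; [exact: kA|exact: kB]. Qed.

Lemma k_open_bigcup (I : Type) (f : I -> set T) :
  (forall i, k_open (f i)) -> k_open (\bigcup_i f i).
Proof. by move=> kf C cC; apply: bigcup_open => i _; exact: kf. Qed.

End KOpen.

Definition kify (T : Type) : Type := T.

HB.instance Definition _ (T : topologicalType) := Choice.on (kify T).
HB.instance Definition _ (T : topologicalType) :=
  isOpenTopological.Build (kify T)
    (@k_openT T) (@k_openI T) (@k_open_bigcup T).

Definition k_space (T : topologicalType) : Prop :=
  forall A : set T, k_open A -> open A.

Definition compactly_generated (T : topologicalType) : Prop :=
  hausdorff_space T /\ k_space T.

Definition kprod (A B : topologicalType) : topologicalType := kify (A * B)%type.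

Section UnitInterval.
Variable R : realType.

Definition unit_interval : Type := set_type (`[0, 1]%classic : set R).

HB.instance Definition _ := Topological.on unit_interval.

Lemma unit_interval0 : (0 : R) \in (`[0, 1]%classic : set R).
Proof. by rewrite inE /= in_itv /= lexx ler01. Qed.

Lemma unit_interval1 : (1 : R) \in (`[0, 1]%classic : set R).
Proof. by rewrite inE /= in_itv /= ler01 lexx. Qed.

Definition ui0 : unit_interval := exist _ 0 unit_interval0.
Definition ui1 : unit_interval := exist _ 1 unit_interval1.

Lemma ui0_neq1 : ui0 != ui1.
Proof. by apply/eqP => /(congr1 val) /= /eqP; rewrite eq_sym oner_eq0. Qed.

HB.instance Definition _ := isBiPointed.Build unit_interval ui0_neq1.

End UnitInterval.


Section Homotopy.
Variable R : realType.
Notation I := (unit_interval R).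

Definition homotopic (A B : topologicalType) (f g : A -> B) : Prop :=
  exists H : kprod A I -> B,
    [/\ continuous H, forall a, H (a, zero) = f a & forall a, H (a, one) = g a].

Definition null_homotopic (A B : topologicalType) (f : A -> B) : Prop :=
  exists b : B, homotopic f (fun=> b).

Definition path_component (T : topologicalType) (x : T) : set T :=
  [set y | inhabited ({path I from x to y in T})].

(* (X, {x0}) is an NDR-pair. *)
Definition nondegenerate (X : topologicalType) (x0 : X) : Prop :=
  exists (u : X -> R) (h : kprod X I -> X),
    [/\ continuous u,
        forall x, 0 <= u x <= 1,
        forall x, u x = 0 <-> x = x0,
        continuous h &
        [/\ forall x, h (x, zero) = x,
            forall t, h (x0, t) = x0 &
            forall x, u x < 1 -> h (x, one) = x0]].

End Homotopy.

Record based_space (R : realType) := BasedSpace {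
  space :> topologicalType;
  space_cg : compactly_generated space;
  basepoint : space;
  basepoint_nondegenerate : nondegenerate R basepoint }.

Record hspace (R : realType) := HSpace {
  hspace_space :> based_space R;
  hmul : hspace_space -> hspace_space -> hspace_space;
  hmul_continuous :
    continuous (fun p : kprod hspace_space hspace_space => hmul p.1 p.2);
  hmul_el : homotopic R (fun g => hmul (basepoint hspace_space) g) id;
  hmul_er : homotopic R (fun g => hmul g (basepoint hspace_space)) id }.

Section KSpaceTheory.

Lemma k_space_continuous (X T : topologicalType) (f : X -> T) :
  k_space X -> continuous f -> continuous (f : X -> kify T).
Proof.
move=> kX cf; apply/continuousP => A kA; apply: kX => C cC.
have cfC : compact (f @` C).
  by apply: continuous_compact => //; exact: continuous_subspaceT.
have /open_subspaceP[U oU UA] := kA _ cfC.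
apply/open_subspaceP; exists (f @^-1` U).
  by move/continuousP : cf; apply.
apply/seteqP; split=> x [fx Cx]; split=> //.
- have : (U `&` f @` C) (f x) by split=> //; exists x.
  by rewrite UA => -[].
- have : (A `&` f @` C) (f x) by split=> //; exists x.
  by rewrite -UA => -[].
Qed.

Lemma compact_k_space (X : topologicalType) : compact [set: X] -> k_space X.
Proof.
move=> cX A kA; have /open_subspaceP[V oV] := kA _ cX.
by rewrite !setIT => <-.
Qed.

Lemma kify_id_continuous (T : topologicalType) :
  continuous (id : kify T -> T).
Proof.
apply/continuousP => A oA.
suff : k_open A by [].
by move=> C cC; apply/open_subspaceP; exists A.
Qed.

Lemma set_type_compact (T : topologicalType) (K : set T) :
  compact K -> compact [set: set_type K].
Proof.
move=> cK F PF _.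
have FK : (set_val @ F) K.
  by apply: (@filterS _ F _ setT) => [x _|]; [exact: set_mem (valP x)|exact: filterT].
have [x [Kx cx]] := cK _ _ FK.
exists (exist _ x (mem_set Kx)); split => // A B FA [/= _ [[W oW <-] Wx WB]].
have FA' : (set_val @ F) (set_val @` A).
  by apply: (@filterS _ F _ A) => // a Aa; exists a.
have nW : nbhs x W by apply: open_nbhs_nbhs.
have [_ [[a Aa <-] Wa]] := cx _ _ FA' nW.
by exists a; split => //; exact: WB.
Qed.

Lemma set_type_hausdorff (T : topologicalType) (K : set T) :
  hausdorff_space T -> hausdorff_space (set_type K).
Proof.
move=> hT x y cl; apply: val_inj; apply: hT => A B nA nB.
have cv : continuous (set_val : set_type K -> T) by exact: initial_continuous.
have [z [Az Bz]] := cl _ _ (cv x _ nA) (cv y _ nB).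
by exists (set_val z).
Qed.

End KSpaceTheory.

Section MapSpace.
Variables X Y : topologicalType.

Definition co_map_space : topologicalType :=
  initial_topology (fun f : continuousType X Y => (f : {compact-open, X -> Y})).

Definition map_space : topologicalType := kify co_map_space.

Definition const_map (y : Y) : map_space := (cst y : continuousType X Y).

Lemma map_space_compact_open :
  continuous (fun f : map_space =>
    ((f : continuousType X Y) : {compact-open, X -> Y})).
Proof.
move=> f; apply: (@continuous_comp map_space co_map_space {compact-open, X -> Y}
  id (fun g : continuousType X Y => (g : {compact-open, X -> Y}))).
  exact: kify_id_continuous.
exact: initial_continuous.
Qed.

End MapSpace.

Section PathComponent.
Variables (R : realType) (T : topologicalType).
Notation I := (unit_interval R).

Lemma path_componentP (x y : T) :
  path_component R x y <->
  exists f : I -> T, [/\ continuous f, f zero = x & f one = y].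
Proof.
split=> [[p]|[f [cf f0 f1]]].
  by exists p; split; [exact: cts_fun|exact: path_zero|exact: path_one].
exact: inhabits (mk_path cf f0 f1 : {path I from x to y in T}).
Qed.

Lemma path_component_refl (x : T) : path_component R x x.
Proof. by apply/path_componentP; exists (cst x); split=> //; exact: cst_continuous. Qed.

Lemma clamp_subproof (s : R) :
  Num.max 0 (Num.min 1 s) \in (`[0, 1]%classic : set R).
Proof. by rewrite inE /= in_itv /= le_max lexx /= ge_max ler01 ge_min lexx. Qed.

Definition clamp (s : R) : I := exist _ (Num.max 0 (Num.min 1 s)) (clamp_subproof s).

Lemma clamp_continuous : continuous clamp.
Proof.
apply: continuous_comp_initial.
apply: (_ : continuous (fun s : R => Num.max 0 (Num.min 1 s))) => s.
by apply: (@continuous_max _ R^o) ; [exact: cvg_cst|apply: continuous_min => //; exact: cvg_cst].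
Qed.

Lemma clamp_le0 (s : R) : s <= 0 -> clamp s = zero.
Proof.
move=> s0; apply: val_inj => /=; apply/max_idPl.
by rewrite ge_min s0 orbT.
Qed.

Lemma clamp_ge1 (s : R) : 1 <= s -> clamp s = one.
Proof.
move=> s1; apply: val_inj => /=.
by rewrite min_l // max_r.
Qed.

Lemma path_component_trans (x y z : T) :
  path_component R x y -> path_component R y z -> path_component R x z.
Proof.
move=> /path_componentP[f [cf f0 f1]] /path_componentP[g [cg g0 g1]].
apply/path_componentP.
pose h (s : R) := if s <= 2^-1 then f (clamp (2 * s)) else g (clamp (2 * s - 1)).
have cf' : continuous (fun s : R => f (clamp (2 * s))).
  move=> s; apply: (@continuous_comp R R T (fun s => 2 * s) (f \o clamp)).
    exact: mulrl_continuous.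
  by apply: continuous_comp; [exact: clamp_continuous|exact: cf].
have cg' : continuous (fun s : R => g (clamp (2 * s - 1))).
  move=> s; apply: (@continuous_comp R R T (fun s => 2 * s - 1) (g \o clamp)).
    by apply: continuousB; [exact: mulrl_continuous|exact: cvg_cst].
  by apply: continuous_comp; [exact: clamp_continuous|exact: cg].
have ch : continuous h.
  apply/continuous_subspace_setT.
  have <- : `]-oo, 2^-1]%classic `|` `[2^-1, +oo[%classic = [set: R].
    apply/seteqP; split=> // s _; rewrite /= !in_itv /= andbT.
    by have [?|/ltW ?] := leP s 2^-1; [left|right].
  apply: withinU_continuous.
  - exact: lray_closed.
  - exact: rray_closed.
  - apply: subspace_eq_continuous; last exact: (continuous_subspaceT cf').
    by move=> s; rewrite inE /= in_itv /= /from_subspace /h => ->.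
  - apply: subspace_eq_continuous; last exact: (continuous_subspaceT cg').
    move=> s; rewrite inE /= in_itv /= andbT /from_subspace /h => s2.
    case: ifPn => // s2'.
    have -> : s = 2^-1 by apply/eqP; rewrite eq_le s2 s2'.
    by rewrite divff ?pnatr_eq0 // subrr clamp_le0 // clamp_ge1 // g0 f1.
exists (h \o (set_val : I -> R)); split.
- move=> t; apply: continuous_comp; last exact: ch.
  exact: initial_continuous.
- by rewrite /= /h /= invr_ge0 ler0n mulr0 clamp_le0.
- have h1 : ((1 : R) <= 2^-1) = false.
    by apply/negbTE; rewrite -ltNge invf_lt1 ?ltr1n ?ltr0n.
  by rewrite /= /h /= h1 mulr1 -[2]/(1 + 1) addrK clamp_ge1.
Qed.

Lemma path_component_sym (x y : T) :
  path_component R x y -> path_component R y x.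
Proof.
move=> /path_componentP[f [cf f0 f1]]; apply/path_componentP.
exists (fun t => f (clamp (1 - set_val t))); split.
- move=> t; apply: (@continuous_comp I R T _ (fun s => f (clamp (1 - s)))).
    exact: initial_continuous.
  apply: (@continuous_comp R I T (fun s => clamp (1 - s)) f); last exact: cf.
  apply: (@continuous_comp R R I (fun s => 1 - s) clamp).
    by apply: continuousB; [exact: cvg_cst|exact: cvg_id].
  exact: clamp_continuous.
- by rewrite clamp_ge1 //= subr0.
- by rewrite clamp_le0 //= subrr.
Qed.

End PathComponent.

Section MapComponent.
Variables (R : realType) (X : based_space R) (G : hspace R).
Notation I := (unit_interval R).
Notation e := (basepoint G).

Lemma hmul_comp_continuous (K : topologicalType) (f g : K -> G) :
  k_space K -> continuous f -> continuous g ->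
  continuous (fun x => hmul (f x) (g x)).
Proof.
move=> kK cf cg.
have cfg : continuous ((fun x => (f x, g x)) : K -> kprod G G).
  by apply: k_space_continuous => // x; apply: cvg_pair; [exact: cf|exact: cg].
move=> x; exact: (continuous_comp (cfg x) (@hmul_continuous R G _)).
Qed.

Lemma map_mul_subproof (f g : continuousType X G) :
  continuous (fun x => hmul (f x) (g x)).
Proof.
by apply: hmul_comp_continuous; [exact: (space_cg X).2|exact: cts_fun..].
Qed.

Definition map_mul (f g : map_space X G) : map_space X G :=
  (mkcts (@map_mul_subproof f g) : continuousType X G).

Lemma unit_interval_compact : compact [set: I].
Proof. exact/set_type_compact/segment_compact. Qed.

Lemma unit_interval_hausdorff : hausdorff_space I.
Proof. exact/set_type_hausdorff/Rhausdorff. Qed.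

Lemma map_mul_path_continuous (p q : I -> map_space X G) :
  continuous p -> continuous q -> continuous (fun t => map_mul (p t) (q t)).
Proof.
move=> cp cq.
apply: (@k_space_continuous I (co_map_space X G)).
  exact/compact_k_space/unit_interval_compact.
apply: continuous_comp_initial => t.
apply/(compact_open_cvgP _ (fmap_filter _ (nbhs_filter t))) => C O cC oO.
pose K := set_type C; have cK := set_type_compact cC.
have hK : hausdorff_space K := set_type_hausdorff (space_cg X).1.
have lK : locally_compact [set: K].
  move=> x _; exists setT; first exact: filterT.
  by split => //; exact: closedT.
have cu (r : I -> map_space X G) : continuous r ->
    continuous (uncurry (fun s (y : K) => (r s : continuousType X G) (set_val y))).
  move=> cr; apply: continuous_uncurry => //.
    move=> s.
    apply/(compact_open_cvgP _ (fmap_filter _ (nbhs_filter s))) => D U cD oU DU.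
    have cr' : continuous
        (fun s : I => ((r s : continuousType X G) : {compact-open, X -> G})).
      by move=> s'; exact: (continuous_comp (cr s') (@map_space_compact_open _ _ _)).
    have cvD : compact (set_val @` D : set X).
      apply: continuous_compact => //; apply: continuous_subspaceT.
      exact: initial_continuous.
    have /(compact_open_cvgP _ (fmap_filter _ (nbhs_filter s))) := cr' s.
    move=> /(_ _ U cvD oU) H.
    have {}H : nbhs s [set s' : I |
        ((r s' : continuousType X G) : X -> G) @` (set_val @` D) `<=` U].
      apply: H => _ [_ [y' Dy' <-] <-]; apply: DU.
      by exists y'.
    apply: (@filterS I (nbhs s) _ _ _ _ H) => s' /= sU _ [y Dy <-].
    by apply: sU; exists (set_val y) => //; exists y.
  move=> s y; apply: continuous_comp; first exact: initial_continuous.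
  exact: cts_fun.
have kIK : k_space (I * K)%type.
  apply: compact_k_space; rewrite -setXTT.
  by apply: compact_setX => //; exact: unit_interval_compact.
have /continuous_curry_fun := hmul_comp_continuous kIK (cu _ cp) (cu _ cq).
move=> /(_ t)/(compact_open_cvgP _ (fmap_filter _ (nbhs_filter t))).
move=> /(_ setT O cK oO) H tO.
have {}H : nbhs t [set s : I | [set hmul ((p s : continuousType X G) (set_val y))
    ((q s : continuousType X G) (set_val y)) | y in [set: K]] `<=` O].
  apply: H => _ [y _ <-]; apply: tO.
  by exists (set_val y) => //; exact: set_mem (valP y).
apply: (@filterS I (nbhs t) _ _ _ _ H) => s /= sO _ [x Cx <-].
by apply: sO; exists (exist _ x (mem_set Cx)).
Qed.

Lemma const_map_continuous : continuous (@const_map X G).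
Proof.
apply: (@k_space_continuous G (co_map_space X G)); first exact: (space_cg G).2.
apply: continuous_comp_initial => y.
apply/(compact_open_cvgP _ (fmap_filter _ (nbhs_filter y))) => C O cC oO yO.
have [->|/set0P[x Cx]] := eqVneq C set0.
  apply: (@filterS G (nbhs y) _ setT); last exact: filterT.
  by move=> z _ ? [? []].
have Oy : O y by apply: yO; exists x.
apply: (@filterS G (nbhs y) _ O); last exact: open_nbhs_nbhs.
by move=> z Oz _ [? _ <-].
Qed.

Definition null_component : set (map_space X G) :=
  path_component R (const_map X e).

Lemma map_mul_component (f g : map_space X G) :
  null_component f -> null_component g -> null_component (map_mul f g).
Proof.
move=> /path_componentP[p [cp p0 p1]] /path_componentP[q [cq q0 q1]].
apply: (@path_component_trans R _ _ (map_mul (const_map X e) (const_map X e))).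
  apply: path_component_sym; have [H [cH H0 H1]] := @hmul_el R G.
  have cHe : continuous (fun t : I => H (e, t)).
    have ci : continuous ((fun t => (e, t)) : I -> kprod G I).
      apply: k_space_continuous; first exact/compact_k_space/unit_interval_compact.
      move=> t; apply: (@cvg_pair I G I (nbhs t) (nbhs e) (nbhs t) _ _ _ (fun=> e) id).
        exact: cvg_cst.
      exact: cvg_id.
    move=> t; apply: (@continuous_comp I (kprod G I) G (fun t => (e, t)) H).
      exact: ci.
    exact: cH.
  apply/path_componentP; exists (fun t => const_map X (H (e, t))); split.
  - by move=> t; apply: continuous_comp; [exact: cHe|exact: const_map_continuous].
  - by rewrite H0; apply/continuousEP.
  - by rewrite H1.
apply/path_componentP; exists (fun t => map_mul (p t) (q t)); split.
- exact: map_mul_path_continuous.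
- by rewrite p0 q0.
- by rewrite p1 q1.
Qed.

(* F(X,G)_o *)
Definition map_component : topologicalType := kify (set_type null_component).

Definition component_mul (f g : map_component) : map_component :=
  exist _ (map_mul (set_val (f : set_type null_component))
                   (set_val (g : set_type null_component)))
    (mem_set (map_mul_component (set_valP f) (set_valP g))).

End MapComponent.

Section Hnil.
Variables (R : realType) (T : topologicalType) (mul : T -> T -> T).

Definition homotopy_associative : Prop :=
  homotopic R (fun p : kprod (kprod T T) T => mul (mul p.1.1 p.1.2) p.2)
              (fun p : kprod (kprod T T) T => mul p.1.1 (mul p.1.2 p.2)).

Definition homotopy_inverse (nu : T -> T) : Prop :=
  [/\ continuous nu, null_homotopic R (fun g => mul (nu g) g)
    & null_homotopic R (fun g => mul g (nu g))].

(* Indices are shifted by one: [kpow n] is the (n+1)-fold power of T, and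
   [phi nu n] is the commutator map phi_{n+1} defined on it. *)
Fixpoint kpow (n : nat) : topologicalType :=
  if n is m.+1 then kprod (kpow m) T else T.

Definition phi2 (nu : T -> T) (g1 g2 : T) : T :=
  mul (mul g1 g2) (mul (nu g1) (nu g2)).

Fixpoint phi (nu : T -> T) (n : nat) : kpow n -> T :=
  match n with
  | 0 => id
  | m.+1 => fun p => phi2 nu (phi nu p.1) p.2
  end.

(* T is group-like and phi_{n+1} is null-homotopic. A homotopy inverse is unique
   up to homotopy, so that the choice of [nu] is immaterial. *)
Definition phi_null_homotopic (n : nat) : Prop :=
  exists nu : T -> T, [/\ homotopy_associative, homotopy_inverse nu
    & null_homotopic R (@phi nu n)].

(* [None] stands for infinity. *)
Definition Hnil : option nat :=
  match pselect (exists n, `[< phi_null_homotopic n >]) with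
  | left ex => Some (ex_minn ex)
  | right _ => None
  end.

End Hnil.

(* A group object in compactly generated spaces: the continuity of the
   multiplication on the product is part of [hspace]. *)
Definition is_topological_group (R : realType) (G : hspace R) : Prop :=
  exists inv : G -> G,
    [/\ continuous inv, associative (@hmul R G),
        left_id (basepoint G) (@hmul R G), right_id (basepoint G) (@hmul R G) &
        left_inverse (basepoint G) inv (@hmul R G) /\
        right_inverse (basepoint G) inv (@hmul R G)].

Section CW.
Variable R : realType.

(* Spelled out because the library norm on ['rV[R]_n] is the sup norm. *)
Definition disk (n : nat) : set 'rV[R]_n :=
  [set x | \sum_(i < n) x ord0 i ^+ 2 <= 1].

Definition open_disk (n : nat) : set 'rV[R]_n :=
  [set x | \sum_(i < n) x ord0 i ^+ 2 < 1].

Definition boundary_sphere (n : nat) : set 'rV[R]_n :=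
  [set x | \sum_(i < n) x ord0 i ^+ 2 = 1].

Arguments disk : clear implicits.
Arguments open_disk : clear implicits.
Arguments boundary_sphere : clear implicits.

Record cw_structure (T : topologicalType) := CWStructure {
  cell : nat -> Type;
  char_map : forall n, cell n -> 'rV[R]_n -> T;
  cw_hausdorff : hausdorff_space T;
  char_map_continuous : forall n (c : cell n),
    {within disk n, continuous (char_map c)};
  (* the open cells partition T, and each one is parametrized injectively *)
  open_cells_cover : forall t : T, exists n (c : cell n) x,
    open_disk n x /\ char_map c x = t;
  open_cells_inj : forall n (c : cell n) x m (d : cell m) y,
    open_disk n x -> open_disk m y -> char_map c x = char_map d y ->
    existT (fun k => (cell k * 'rV[R]_k)%type) n (c, x) =
    existT (fun k => (cell k * 'rV[R]_k)%type) m (d, y);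
  closure_finite : forall n (c : cell n),
    exists D : set {m : nat & cell m},
      [/\ finite_set D,
          forall d, D d -> (projT1 d < n)%N &
          forall x, boundary_sphere n x -> exists2 d, D d &
            exists2 y, open_disk (projT1 d) y &
              char_map (projT2 d) y = char_map c x];
  weak_topology_closed : forall A : set T,
    (forall n (c : cell n), closed (disk n `&` char_map c @^-1` A)) -> closed A }.

Definition is_CW_complex (T : topologicalType) : Prop :=
  inhabited (cw_structure T).

End CW.

(* Main.v *)
(* The exponential law for compactly generated spaces makes F(X,-)_o act on maps
   and homotopies, so null-homotopies of the commutator maps of G induce
   null-homotopies of those of F(X,G)_o. Conversely, G is a retract of F(X,G)_o
   by the constant maps c and the evaluation r at the basepoint. A homotopy
   inverse N on F(X,G)_o yields the homotopy inverse nu = r N c on G; both nu r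
   and r N invert the H-map r, hence are homotopic, so that phi_n for nu is
   homotopic to r phi_n c^n, with phi_n formed using N. This avoids the general
   existence of homotopy inverses on connected CW H-spaces. All null-homotopies
   being free, one needs G to be path-connected: for a group, because a
   nondegenerate basepoint makes the path components open. *)
Require Import Defs.
From mathcomp Require Import all_boot all_order all_algebra.
From mathcomp Require Import all_classical all_reals all_analysis.

Set Implicit Arguments.
Unset Strict Implicit.
Unset Printing Implicit Defensive.

Import Order.TTheory GRing.Theory Num.Theory.
Import numFieldNormedType.Exports.

Local Open Scope classical_set_scope.
Local Open Scope ring_scope.

(** * Continuity and compactly generated products *)

Lemma continuousT_comp (S T U : topologicalType) (f : S -> T) (g : T -> U) :
  continuous f -> continuous g -> continuous (g \o f).
Proof. by move=> cf cg x; apply: continuous_comp; [exact: cf|exact: cg]. Qed.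

Lemma continuousT_pair (S T U : topologicalType) (f : S -> T) (g : S -> U) :
  continuous f -> continuous g -> continuous (fun x => (f x, g x)).
Proof. by move=> cf cg x; apply: cvg_pair; [exact: cf|exact: cg]. Qed.

Section CompactlyGeneratedProducts.

(** Replaces the subspace topology on compact sets by honest compact spaces [set_type C], so that
    k-openness can be tested along continuous maps. *)
Lemma k_open_set_type (T : topologicalType) (A : set T) :
  (forall C, compact C -> open (set_val @^-1` A : set (set_type C))) ->
  k_open A.
Proof.
move=> oA C cC; have [W oW WA] := oA C cC.
apply/open_subspaceP; exists W => //; apply/seteqP; split=> x [xA Cx]; split=> //.
  have : (set_val @^-1` W) (exist _ x (mem_set Cx) : set_type C) by [].
  by rewrite WA.
have : (set_val @^-1` A) (exist _ x (mem_set Cx) : set_type C) by [].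
by rewrite -WA.
Qed.

Lemma set_val_continuous (T : topologicalType) (C : set T) :
  continuous (set_val : set_type C -> T).
Proof. exact: initial_continuous. Qed.

Lemma set_type_lift_continuous (S T : topologicalType) (C : set T)
    (f : S -> set_type C) :
  continuous (set_val \o f) -> continuous f.
Proof. exact: continuous_comp_initial. Qed.

(** A compact set [C] of [T] stays compact in [kify T]: [set_type C] is compact, hence a k-space, so
    its inclusion lifts continuously to [kify T]. Testing on compact sets a second time therefore
    yields no new open sets. *)
Lemma kify_k_space (T : topologicalType) : k_space (kify T).
Proof.
move=> A kA.
suff : k_open (A : set T) by [].
apply: k_open_set_type => C cC.
have kC : k_space (set_type C) by exact/compact_k_space/set_type_compact.
have cv : continuous (set_val : set_type C -> kify T).
  by apply: k_space_continuous => //; exact: set_val_continuous.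
have cC' : compact (C : set (kify T)).
  have -> : (C : set (kify T)) = set_val @` [set: set_type C].
    apply/seteqP; split=> [x Cx|_ [y _ <-]].
      by exists (exist _ x (mem_set Cx)).
    exact: set_mem (valP y).
  apply: continuous_compact; last exact: set_type_compact.
  exact: continuous_subspaceT.
have [W oW WA] := (open_subspaceP _ _).1 (kA _ cC').
have -> : set_val @^-1` A = set_val @^-1` W :> set (set_type C).
  apply/seteqP; split=> x xA; have Cx : C (set_val x) := set_valP x.
    by have [] : (W `&` C) (set_val x) by rewrite WA.
  by have [] : (A `&` C) (set_val x) by rewrite -WA.
by move/continuousP : cv; exact.
Qed.

Variables A B : topologicalType.

Lemma kprod_k_space : k_space (kprod A B).
Proof. exact: kify_k_space. Qed.

Lemma kfst_continuous : continuous (fst : kprod A B -> A).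
Proof.
apply: (@continuousT_comp (kprod A B) (A * B)%type A id fst).
  exact: kify_id_continuous.
by move=> x; exact: cvg_fst.
Qed.

Lemma ksnd_continuous : continuous (snd : kprod A B -> B).
Proof.
apply: (@continuousT_comp (kprod A B) (A * B)%type B id snd).
  exact: kify_id_continuous.
by move=> x; exact: cvg_snd.
Qed.

Lemma kpair_continuous (K : topologicalType) (f : K -> A) (g : K -> B) :
  k_space K -> continuous f -> continuous g ->
  continuous ((fun x => (f x, g x)) : K -> kprod A B).
Proof.
by move=> kK cf cg; apply: k_space_continuous => //; exact: continuousT_pair.
Qed.

(** Every compact set of the ordinary product lies in the rectangle spanned by its two projections,
    which are compact. *)
Lemma kprod_continuous (Y : topologicalType) (f : kprod A B -> Y) :
  (forall (C : set A) (D : set B), compact C -> compact D ->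
    continuous (fun p : set_type C * set_type D =>
      f (set_val p.1, set_val p.2))) ->
  continuous f.
Proof.
move=> cf; apply/continuousP => U oU.
suff : k_open (f @^-1` U : set (A * B)) by [].
apply: k_open_set_type => E cE.
have cproj (Z : topologicalType) (h : A * B -> Z) : continuous h ->
    compact (h @` E).
  by move=> ch; apply: continuous_compact => //; exact: continuous_subspaceT.
pose C := fst @` E; pose D := snd @` E.
have cC : compact C by apply: cproj => x; exact: cvg_fst.
have cD : compact D by apply: cproj => x; exact: cvg_snd.
have EC (x : set_type E) : C (set_val x).1.
  by exists (set_val x) => //; exact: set_valP.
have ED (x : set_type E) : D (set_val x).2.
  by exists (set_val x) => //; exact: set_valP.
pose r (x : set_type E) : set_type C * set_type D :=
  (exist _ (set_val x).1 (mem_set (EC x)), exist _ (set_val x).2 (mem_set (ED x))).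
have cr : continuous r.
  apply: (@continuousT_pair (set_type E) (set_type C) (set_type D)).
    apply: set_type_lift_continuous.
    apply: (@continuousT_comp (set_type E) (A * B)%type A set_val fst).
      exact: set_val_continuous.
    by move=> x; exact: cvg_fst.
  apply: set_type_lift_continuous.
  apply: (@continuousT_comp (set_type E) (A * B)%type B set_val snd).
    exact: set_val_continuous.
  by move=> x; exact: cvg_snd.
have := continuousT_comp cr (cf C D cC cD) => /continuousP /(_ U oU).
congr open; apply/seteqP; split => x /=; by rewrite -surjective_pairing.
Qed.

End CompactlyGeneratedProducts.

(** * Function spaces and the exponential law *)

Section MapOf.
Variables X Y : topologicalType.

Definition mapof (f : map_space X Y) : X -> Y :=
  (f : continuousType X Y).

Lemma mapof_continuous (f : map_space X Y) : continuous (mapof f).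
Proof. exact: cts_fun. Qed.

Lemma mapof_inj (f g : map_space X Y) : mapof f =1 mapof g -> f = g.
Proof. by move=> fg; apply/continuousEP. Qed.

End MapOf.

Section ExponentialLaw.
Variables Z X Y : topologicalType.

(** On a compact rectangle the second factor is compact Hausdorff, hence locally compact, and
    ordinary uncurrying for the compact-open topology applies. Restriction to [D] is harmless, since
    compact sets of [set_type D] have compact image in [X]. *)
Lemma map_space_uncurry (F : Z -> map_space X Y) :
  hausdorff_space X -> continuous F ->
  continuous (fun p : kprod Z X => mapof (F p.1) p.2).
Proof.
move=> hX cF; apply: kprod_continuous => C D cC cD.
pose f (s : set_type C) (y : set_type D) := mapof (F (set_val s)) (set_val y).
have -> : (fun p => mapof (F (set_val p.1, set_val p.2).1)
    (set_val p.1, set_val p.2).2) = uncurry f by apply/funext => -[].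
have hK : hausdorff_space (set_type D) := set_type_hausdorff hX.
have lK : locally_compact [set: set_type D].
  move=> x _; exists setT; first exact: filterT.
  by split; [exact: set_type_compact|exact: closedT].
apply: continuous_uncurry => //; last first.
  move=> s; apply: (@continuousT_comp (set_type D) X Y set_val).
    exact: set_val_continuous.
  exact: mapof_continuous.
move=> s.
apply/(compact_open_cvgP _ (fmap_filter _ (nbhs_filter s))) => E U cE oU EU.
have cF' : continuous (fun s : set_type C =>
    ((F (set_val s) : continuousType X Y) : {compact-open, X -> Y})).
  apply: (@continuousT_comp (set_type C) Z {compact-open, X -> Y} set_val
    (fun z => (F z : continuousType X Y))); first exact: set_val_continuous.
  apply: (@continuousT_comp Z (map_space X Y) {compact-open, X -> Y} F
    (fun f => (f : continuousType X Y))) => //.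
  exact: map_space_compact_open.
have cvE : compact (set_val @` E : set X).
  apply: continuous_compact => //; apply: continuous_subspaceT.
  exact: set_val_continuous.
have /(compact_open_cvgP _ (fmap_filter _ (nbhs_filter s))) := cF' s.
move=> /(_ _ U cvE oU) H.
have {}H : nbhs s [set s' : set_type C |
    mapof (F (set_val s')) @` (set_val @` E) `<=` U].
  by apply: H => _ [_ [y' Ey' <-] <-]; apply: EU; exists y'.
apply: (@filterS (set_type C) (nbhs s) _ _ _ _ H) => s' /= sU _ [y Ey <-].
by apply: sU; exists (set_val y) => //; exists y.
Qed.

(** Only a compact [C] in [Z] and a compact [D] in [X] matter at a time: the first because [Z] is a
    k-space, the second by the compact-open topology. Their ordinary product is compact, hence a
    k-space mapping continuously to [kprod Z X], and ordinary currying finishes. *)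
Lemma map_space_curry (F : Z -> map_space X Y) :
  k_space Z -> continuous (fun p : kprod Z X => mapof (F p.1) p.2) ->
  continuous F.
Proof.
move=> kZ cF; apply: k_space_continuous => //.
apply: continuous_comp_initial; apply/continuousP => W oW.
apply: kZ; apply: k_open_set_type => C cC.
suff : continuous (fun s : set_type C =>
    ((F (set_val s) : continuousType X Y) : {compact-open, X -> Y})).
  by move/continuousP; exact.
move=> s.
apply/(compact_open_cvgP _ (fmap_filter _ (nbhs_filter s))) => D O cD oO DO.
have kCD : k_space (set_type C * set_type D)%type.
  apply: compact_k_space; rewrite -setXTT.
  by apply: compact_setX => //; exact: set_type_compact.
pose f (p : set_type C * set_type D) := mapof (F (set_val p.1)) (set_val p.2).
have cf : continuous f.
  apply: (@continuousT_comp (set_type C * set_type D)%type (kprod Z X) Y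
    (fun p => (set_val p.1, set_val p.2))) cF.
  apply: kpair_continuous => //.
    apply: (@continuousT_comp (set_type C * set_type D)%type (set_type C) Z
      fst set_val); [by move=> x; exact: cvg_fst|exact: set_val_continuous].
  apply: (@continuousT_comp (set_type C * set_type D)%type (set_type D) X
    snd set_val); [by move=> x; exact: cvg_snd|exact: set_val_continuous].
have /(_ s)/(compact_open_cvgP _ (fmap_filter _ (nbhs_filter s))) :=
  continuous_curry_fun cf.
move=> /(_ setT O (set_type_compact cD) oO) H.
have {}H : nbhs s [set s' : set_type C |
    [set f (s', y) | y in [set: set_type D]] `<=` O].
  apply: H => _ [y _ <-]; apply: DO.
  by exists (set_val y) => //; exact: set_valP.
apply: (@filterS (set_type C) (nbhs s) _ _ _ _ H) => s' /= sO _ [x Dx <-].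
by apply: sO; exists (exist _ x (mem_set Dx)).
Qed.

End ExponentialLaw.

(** * The homotopy relation *)

Section HomotopyRelation.
Variable R : realType.
Notation I := (unit_interval R).
Notation "f ~~h g" := (homotopic R f g) (at level 70).

Lemma unit_interval_k_space : k_space I.
Proof. exact/compact_k_space/unit_interval_compact. Qed.

Variables A B : topologicalType.
Implicit Types f g h : A -> B.

Lemma homotopic_refl f : continuous f -> f ~~h f.
Proof.
move=> cf; exists (f \o fst); split => //.
exact: (continuousT_comp (@kfst_continuous A I) cf).
Qed.

Lemma ktime_continuous (r : I -> I) : continuous r ->
  continuous ((fun p => (p.1, r p.2)) : kprod A I -> kprod A I).
Proof.
move=> cr; apply: kpair_continuous; first exact: kprod_k_space.
  exact: kfst_continuous.
exact: (continuousT_comp (@ksnd_continuous A I) cr).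
Qed.

(** Reversal, the two halves of a concatenation and rescaling of time all have this form; clamping
    supplies membership in the unit interval. *)
Lemma affine_clamp_continuous (a b : R) :
  continuous (fun t : I => clamp (a * set_val t + b)).
Proof.
apply: (@continuousT_comp I R I (fun t => a * set_val t + b) (@clamp R));
  last exact: clamp_continuous.
apply: (@continuousT_comp I R R set_val (fun t => a * t + b)).
  exact: set_val_continuous.
by move=> t; apply: continuousD; [exact: mulrl_continuous|exact: cvg_cst].
Qed.

Lemma homotopic_sym f g : f ~~h g -> g ~~h f.
Proof.
move=> [H [cH H0 H1]].
exists (fun p => H (p.1, clamp (-1 * set_val p.2 + 1))); split.
- exact: (continuousT_comp (ktime_continuous (@affine_clamp_continuous _ _)) cH).
- by move=> a; rewrite clamp_ge1 ?H1 //= mulr0 add0r.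
- by move=> a; rewrite clamp_le0 ?H0 //= mulr1 addNr.
Qed.

Lemma homotopic_trans g f h : f ~~h g -> g ~~h h -> f ~~h h.
Proof.
move=> [H [cH H0 H1]] [K [cK K0 K1]].
pose H' (p : kprod A I) := H (p.1, clamp (2 * set_val p.2 + 0)).
pose K' (p : kprod A I) := K (p.1, clamp (2 * set_val p.2 + -1)).
have cH' : continuous H'.
  exact: (continuousT_comp (ktime_continuous (@affine_clamp_continuous _ _)) cH).
have cK' : continuous K'.
  exact: (continuousT_comp (ktime_continuous (@affine_clamp_continuous _ _)) cK).
pose s (p : kprod A I) : R := set_val p.2.
have cs : continuous s.
  apply: (@continuousT_comp (kprod A I) I R snd set_val).
    exact: ksnd_continuous.
  exact: set_val_continuous.
exists (fun p => if s p <= 2^-1 then H' p else K' p); split.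
- apply/continuous_subspace_setT.
  have <- : s @^-1` `]-oo, 2^-1] `|` s @^-1` `[2^-1, +oo[ = [set: kprod A I].
    apply/seteqP; split=> // p _; rewrite /= !in_itv /= andbT.
    by have [?|/ltW ?] := leP (s p) 2^-1; [left|right].
  have closed_s (V : set R) : closed V -> closed (s @^-1` V).
    by move=> cV; apply: preimage_closed => // p _; exact: cs.
  apply: withinU_continuous.
  - by apply: closed_s; exact: lray_closed.
  - by apply: closed_s; exact: rray_closed.
  - apply: subspace_eq_continuous; last exact: (continuous_subspaceT cH').
    by move=> p; rewrite inE /= in_itv /= /from_subspace => ->.
  - apply: subspace_eq_continuous; last exact: (continuous_subspaceT cK').
    move=> p; rewrite inE /= in_itv /= andbT /from_subspace => s2.
    case: ifPn => // s2'; rewrite /H' /K'.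
    have -> : set_val p.2 = 2^-1 :> R by apply/eqP; rewrite eq_le s2 s2'.
    by rewrite divff ?pnatr_eq0 // subrr clamp_le0 // clamp_ge1 ?addr0 // K0 H1.
- by move=> a; rewrite /s /= invr_ge0 ler0n /H' /= mulr0 addr0 clamp_le0.
- have h1 : ((1 : R) <= 2^-1) = false.
    by apply/negbTE; rewrite -ltNge invf_lt1 ?ltr1n ?ltr0n.
  by move=> a; rewrite /s /= h1 /K' /= mulr1 -[2]/(1 + 1) addrK clamp_ge1.
Qed.

Lemma homotopic_precomp (C : topologicalType) (k : C -> A) f g :
  continuous k -> f ~~h g -> f \o k ~~h g \o k.
Proof.
move=> ck [H [cH H0 H1]]; exists (fun p => H (k p.1, p.2)); split.
- apply: (@continuousT_comp (kprod C I) (kprod A I) B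
    (fun p => (k p.1, p.2)) H) => //.
  apply: kpair_continuous; first exact: kprod_k_space.
    exact: (continuousT_comp (@kfst_continuous C I) ck).
  exact: ksnd_continuous.
- by move=> c; exact: H0.
- by move=> c; exact: H1.
Qed.

Lemma homotopic_postcomp (C : topologicalType) (k : B -> C) f g :
  continuous k -> f ~~h g -> k \o f ~~h k \o g.
Proof.
move=> ck [H [cH H0 H1]]; exists (k \o H); split.
- exact: continuousT_comp.
- by move=> a; rewrite /= H0.
- by move=> a; rewrite /= H1.
Qed.

Lemma homotopic_pair (C : topologicalType) (f f' : A -> B) (g g' : A -> C) :
  f ~~h f' -> g ~~h g' ->
  ((fun a => (f a, g a)) : A -> kprod B C) ~~h (fun a => (f' a, g' a)).
Proof.
move=> [H [cH H0 H1]] [K [cK K0 K1]]; exists (fun p => (H p, K p)); split.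
- by apply: kpair_continuous => //; exact: kprod_k_space.
- by move=> a; rewrite H0 K0.
- by move=> a; rewrite H1 K1.
Qed.

Lemma path_component_homotopic_cst (x y : B) :
  path_component R x y -> (fun _ : A => x) ~~h (fun=> y).
Proof.
move=> /path_componentP[p [cp p0 p1]]; exists (p \o snd); split.
- exact: (continuousT_comp (@ksnd_continuous A I) cp).
- by move=> a /=; rewrite p0.
- by move=> a /=; rewrite p1.
Qed.

Lemma homotopic_path_component f g (a : A) :
  f ~~h g -> path_component R (f a) (g a).
Proof.
move=> [H [cH H0 H1]]; apply/path_componentP; exists (fun t => H (a, t)).
split => //; apply: (@continuousT_comp I (kprod A I) B (fun t => (a, t)) H) => //.
apply: kpair_continuous; [exact: unit_interval_k_space| |].
  exact: cst_continuous.
by move=> t; exact: cvg_id.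
Qed.

Lemma path_component_image (k : A -> B) (x y : A) :
  continuous k -> path_component R x y -> path_component R (k x) (k y).
Proof.
move=> ck /path_componentP[p [cp p0 p1]]; apply/path_componentP.
exists (k \o p); split; first exact: continuousT_comp.
  by rewrite /= p0.
by rewrite /= p1.
Qed.

End HomotopyRelation.

(** * Path-connectedness of connected groups and CW complexes *)

Section PathConnected.
Variables (R : realType) (T : topologicalType).

Lemma connected_path_component (x : T) : connected [set: T] ->
  open (path_component R x) -> closed (path_component R x) ->
  path_component R x = setT.
Proof.
move=> cT oP cP; apply: cT.
- by exists x; exact: path_component_refl.
- by exists (path_component R x) => //; rewrite setTI.
- by exists (path_component R x) => //; rewrite setTI.
Qed.

Lemma connected_locally_path_connected (x : T) : connected [set: T] ->
  (forall y : T, nbhs y (path_component R y)) -> path_component R x = setT.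
Proof.
move=> cT nP; apply: connected_path_component => //.
  rewrite openE => y xy; apply: filterS (nP y) => z.
  exact: path_component_trans.
rewrite -openC openE => y nxy; apply: filterS (nP y) => z yz xz.
by apply: nxy; apply: path_component_trans xz _; exact: path_component_sym.
Qed.

End PathConnected.

(** The NDR deformation carries each point of the open set [u < 1] to [e], and its track is the
    required path. *)
Lemma nondegenerate_path_component (R : realType) (T : topologicalType) (e : T) :
  Defs.nondegenerate R e -> nbhs e (path_component R e).
Proof.
move=> [u [h [cu u01 u0 ch [h0 _ h1]]]].
have : nbhs e (u @^-1` [set r | r < 1]).
  apply: open_nbhs_nbhs; split; last by rewrite /= (u0 e).2.
  by move/continuousP : cu; apply; exact: open_lt.
apply: filterS => x ux.
have xe : homotopic R (id : T -> T) (fun y => h (y, one)).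
  by exists h; split.
apply: path_component_sym; have := homotopic_path_component x xe.
by rewrite h1.
Qed.

(** Left translation by [inv g] pulls the neighbourhood of the identity back to one of [g];
    translating paths by [g] joins its points to [g]. *)
Lemma group_path_connected (R : realType) (G : hspace R) :
  connected [set: G] -> is_topological_group G ->
  path_component R (basepoint G) = setT.
Proof.
move=> cG [inv [_ mulA mul1g mulg1 [mulVg mulgV]]].
have mul_continuous (g : G) : continuous (hmul g).
  move=> x; apply: (@hmul_comp_continuous R G G (fun=> g) id).
  - exact: (space_cg G).2.
  - exact: cst_continuous.
  - by move=> y; exact: cvg_id.
apply: connected_locally_path_connected => // g.
have ne := nondegenerate_path_component (@basepoint_nondegenerate R G).
have : nbhs g (hmul (inv g) @^-1` path_component R (basepoint G)).
  by apply: (mul_continuous (inv g) g); rewrite mulVg.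
apply: filterS => y /= ey.
have := path_component_image (mul_continuous g) ey.
by rewrite mulA mulgV mul1g mulg1.
Qed.

(** The radial segment from 0 to [v] stays in the disk; factoring it through [set_type] of the disk
    makes continuity within the disk sufficient. *)
Lemma disk_continuous_path_component (R : realType) (T : topologicalType) n
    (f : 'rV[R]_n -> T) (v : 'rV[R]_n) :
  {within @disk R n, continuous f} -> disk v -> path_component R (f 0) (f v).
Proof.
move=> cf dv; apply/path_componentP.
have dl (t : unit_interval R) : disk (set_val t *: v).
  have : (`[0, 1]%classic : set R) (set_val t) := set_valP t.
  rewrite /= in_itv /= => /andP[t0 t1].
  apply: le_trans dv; apply: ler_sum => i _; rewrite mxE exprMn.
  by rewrite ler_piMl ?sqr_ge0 // expr_le1.
exists (fun t => f (set_val t *: v)); split.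
- apply: (@continuousT_comp (unit_interval R) (set_type (@disk R n)) T
    (fun t => exist _ (set_val t *: v) (mem_set (dl t))) (f \o set_val)).
    apply: set_type_lift_continuous.
    apply: (@continuousT_comp (unit_interval R) R 'rV[R]_n set_val (fun t => t *: v)).
      exact: set_val_continuous.
    by move=> t; exact: scalel_continuous.
  apply/continuousP => U oU; move/continuousP : cf => /(_ U oU).
  move=> /open_subspaceP[V oV VU]; exists V => //.
  apply/seteqP; split=> x xV; have dx : disk (set_val x) := set_valP x.
    by have [] : (f @^-1` U `&` @disk R n) (set_val x) by rewrite -VU.
  by have [] : (V `&` @disk R n) (set_val x) by rewrite VU.
- by rewrite /= scale0r.
- by rewrite /= scale1r.
Qed.

Lemma cw_path_connected (R : realType) (T : topologicalType) (e : T) :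
  connected [set: T] -> is_CW_complex R T -> path_component R e = setT.
Proof.
move=> cT [W].
have closed_disk n : closed (@disk R n).
  rewrite (_ : @disk R n =
    (fun v : 'rV[R]_n => \sum_(i < n) v ord0 i ^+ 2) @^-1` `]-oo, 1]); last by apply/seteqP; split=> v; rewrite /= in_itv.
  apply: preimage_closed; last exact: lray_closed.
  move=> v _.
  have : continuous (fun v : 'rV[R]_n => \sum_(i < n) v ord0 i ^+ 2).
    apply: continuous_big => [|i _]; first exact: add_continuous.
    apply: (@continuousT_comp 'rV[R]_n R R (fun v => v ord0 i) (fun x => x ^+ 2)).
      exact: coord_continuous.
    exact: exprn_continuous.
  exact.
  (* A union of path components meets each disk in all or nothing. *)
  have closedP (P : set T) :
    (forall x y, path_component R x y -> P x -> P y) -> closed P.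
  move=> PP; apply: (weak_topology_closed (c0:=W)) => n c.
  have ch v : @disk R n v -> path_component R (char_map c 0) (char_map c v).
    by move=> dv; apply: disk_continuous_path_component => //;
      exact: char_map_continuous.
  have [P0|nP0] := pselect (P (char_map c 0)).
    rewrite (_ : _ `&` _ = @disk R n) //; apply/seteqP; split=> [v []//|v dv].
    by split=> //; apply: PP P0; exact: ch.
  rewrite (_ : _ `&` _ = set0); first exact: closed0.
  apply/seteqP; split=> // v [dv Pv]; apply: nP0.
  by apply: PP Pv; exact/path_component_sym/ch.
apply: connected_path_component => //.
  (* The complement of a path component is again a union of path components, so it is closed too. *)
  rewrite -closedC; apply: closedP => x y xy nex ey; apply: nex.
  by apply: path_component_trans ey _; exact: path_component_sym.
by apply: closedP => x y xy ex; apply: path_component_trans xy.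
Qed.

(** * Powers of maps and naturality of the commutator maps *)

Section KPow.
Variables (A B : topologicalType).

Fixpoint kmap (r : A -> B) (n : nat) : kpow A n -> kpow B n :=
  match n with
  | 0 => r
  | m.+1 => fun p => (@kmap r m p.1, r p.2)
  end.

Lemma kmap_continuous (r : A -> B) n : continuous r -> continuous (@kmap r n).
Proof.
move=> cr; elim: n => [//|n IHn] /=.
apply: kpair_continuous; first exact: kprod_k_space.
  exact: (continuousT_comp (@kfst_continuous (kpow A n) A) IHn).
exact: (continuousT_comp (@ksnd_continuous (kpow A n) A) cr).
Qed.

(** Meant for evaluation at a point of [X], which commutes strictly with pointwise operations. *)
Lemma phi_kmap (mulA : A -> A -> A) (mulB : B -> B -> B) (nuA : A -> A)
    (nuB : B -> B) (r : A -> B) n (p : kpow A n) :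
  (forall a b, r (mulA a b) = mulB (r a) (r b)) ->
  (forall a, r (nuA a) = nuB (r a)) ->
  r (phi mulA nuA p) = phi mulB nuB (kmap r p).
Proof.
move=> rM rV; elim: n p => [//|n IHn] p.
by rewrite /= /phi2 !rM !rV IHn.
Qed.

End KPow.

Lemma kmap_comp_id (A B : topologicalType) (r : A -> B) (s : B -> A) n
    (p : kpow B n) : (forall b, r (s b) = b) -> kmap r (kmap s p) = p.
Proof.
move=> rs; elim: n p => [p|n IHn [p b]] /=; first exact: rs.
by rewrite IHn rs.
Qed.

(** * Homotopy calculus in a path-connected H-space *)

Section HSpaceHomotopy.
Variables (R : realType) (G : hspace R) (K : topologicalType).
Notation e := (basepoint G).
Notation "f ~~h g" := (homotopic R f g) (at level 70).
Implicit Types f g u v a : K -> G.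

Lemma homotopic_hmul f f' g g' : f ~~h f' -> g ~~h g' ->
  (fun k => hmul (f k) (g k)) ~~h (fun k => hmul (f' k) (g' k)).
Proof.
move=> ff gg; have := homotopic_pair ff gg.
exact: (homotopic_postcomp (@hmul_continuous R G)).
Qed.

Hypothesis pathG : forall y, path_component R e y.

(** Free null-homotopies end at arbitrary constants: a path slides [b] to the identity, where the
    homotopy unit law applies. *)
Lemma homotopic_hmul_cst u b : continuous u -> (fun k => hmul (u k) b) ~~h u.
Proof.
move=> cu; have := homotopic_precomp cu (hmul_er G).
apply: homotopic_trans; apply: homotopic_hmul; first exact: homotopic_refl.
exact/path_component_homotopic_cst/path_component_sym/pathG.
Qed.

Lemma homotopic_cst_hmul u b : continuous u -> (fun k => hmul b (u k)) ~~h u.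
Proof.
move=> cu; have := homotopic_precomp cu (hmul_el G).
apply: homotopic_trans; apply: homotopic_hmul; last exact: homotopic_refl.
exact/path_component_homotopic_cst/path_component_sym/pathG.
Qed.

(** The usual chain [u ~ u c ~ u (a v) ~ (u a) v ~ b v ~ v], with the constants [c] and [b] absorbed
    as above. *)
Lemma homotopic_inverse_unique a u v : k_space K ->
  continuous a -> continuous u -> continuous v ->
  homotopy_associative R (@hmul R G) ->
  null_homotopic R (fun k => hmul (u k) (a k)) ->
  null_homotopic R (fun k => hmul (a k) (v k)) ->
  u ~~h v.
Proof.
move=> kK ca cu cv hA [b ub] [c vc].
apply: homotopic_trans (homotopic_sym (homotopic_hmul_cst c cu)) _.
apply: homotopic_trans (homotopic_hmul (homotopic_refl R cu) (homotopic_sym vc)) _.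
apply: homotopic_trans (homotopic_cst_hmul b cv).
apply: homotopic_trans (homotopic_hmul ub (homotopic_refl R cv)).
apply: homotopic_sym.
have cuav : continuous ((fun k => ((u k, a k), v k)) : K -> kprod (kprod G G) G).
  by apply: kpair_continuous => //; exact: kpair_continuous.
exact: (homotopic_precomp cuav hA).
Qed.

End HSpaceHomotopy.

(** * Evaluation and homotopies on the identity component of the function space *)

Section MapComponentTheory.
Variables (R : realType) (X : based_space R) (G : hspace R).
Notation I := (unit_interval R).
Notation e := (basepoint G).
Notation M := (map_component X G).

Definition ev (f : M) : X -> G :=
  mapof (set_val (f : set_type (@null_component R X G))).

Lemma ev_inj (f g : M) : ev f =1 ev g -> f = g.
Proof. by move=> fg; apply: val_inj; exact: mapof_inj. Qed.

Lemma ev_mul (f g : M) x : ev (component_mul f g) x = hmul (ev f x) (ev g x).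
Proof. by []. Qed.

Lemma map_component_k_space : k_space M.
Proof. exact: kify_k_space. Qed.

Lemma ev_uncurry_continuous : continuous (fun p : kprod M X => ev p.1 p.2).
Proof.
apply: (map_space_uncurry (F := fun f : M =>
  set_val (f : set_type (@null_component R X G)))).
  exact: (space_cg X).1.
apply: (@continuousT_comp M (set_type (@null_component R X G)) _ id set_val).
  exact: kify_id_continuous.
exact: set_val_continuous.
Qed.

Lemma map_component_curry (Z : topologicalType) (F : Z -> M) : k_space Z ->
  continuous (fun p : kprod Z X => ev (F p.1) p.2) -> continuous F.
Proof.
move=> kZ cF.
apply: (@k_space_continuous Z (set_type (@null_component R X G))) => //.
by apply: set_type_lift_continuous; apply: map_space_curry.
Qed.

Lemma ev_continuous (x : X) : continuous (ev^~ x).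
Proof.
apply: (@continuousT_comp M (kprod M X) G
  (fun f => (f, x)) (fun p => ev p.1 p.2));
  last exact: ev_uncurry_continuous.
apply: kpair_continuous; first exact: map_component_k_space.
  by move=> f; exact: cvg_id.
exact: cst_continuous.
Qed.

(** Joint evaluation from the power of [M] times [X] to the power of [G]; homotopies on powers of
    [G] are transported along it. *)
Lemma kmap_ev_continuous n :
  continuous (fun p : kprod (kpow M n) X => kmap (ev^~ p.2) p.1).
Proof.
elim: n => [|n IHn] /=; first exact: ev_uncurry_continuous.
have c1 : continuous (fst : kprod (kprod (kpow M n) M) X -> kprod (kpow M n) M).
  exact: kfst_continuous.
have c2 : continuous (snd : kprod (kprod (kpow M n) M) X -> X).
  exact: ksnd_continuous.
apply: kpair_continuous; first exact: kprod_k_space.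
  refine (@continuousT_comp (kprod (kprod (kpow M n) M) X)
    (kprod (kpow M n) X) _ (fun p => (p.1.1, p.2)) _ _ IHn).
  apply: kpair_continuous => //; first exact: kprod_k_space.
  exact: (continuousT_comp c1 (@kfst_continuous _ _)).
refine (@continuousT_comp (kprod (kprod (kpow M n) M) X)
  (kprod M X) _ (fun p => (p.1.2, p.2)) _ _ ev_uncurry_continuous).
apply: kpair_continuous => //; first exact: kprod_k_space.
exact: (continuousT_comp c1 (@ksnd_continuous _ _)).
Qed.

(** The homotopy is the adjoint of [((z, t), x) |-> H (E (z, x), t)]. *)
Lemma homotopic_map_component (Z B : topologicalType) (E : kprod Z X -> B)
    (f g : B -> G) (F F' : Z -> M) :
  continuous E -> homotopic R f g ->
  (forall z x, ev (F z) x = f (E (z, x))) ->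
  (forall z x, ev (F' z) x = g (E (z, x))) ->
  homotopic R F F'.
Proof.
move=> cE [H [cH H0 H1]] Ff Fg.
pose h (p : kprod (kprod Z I) X) : G := H (E (p.1.1, p.2), p.1.2).
have ch : continuous h.
  have c1 : continuous (fst : kprod (kprod Z I) X -> kprod Z I).
    exact: kfst_continuous.
  have kD : k_space (kprod (kprod Z I) X) by exact: kprod_k_space.
  refine (@continuousT_comp (kprod (kprod Z I) X) (kprod B I) _
    (fun p => (E (p.1.1, p.2), p.1.2)) _ _ cH).
  apply: kpair_continuous => //; last first.
    exact: (continuousT_comp c1 (@ksnd_continuous _ _)).
  refine (@continuousT_comp (kprod (kprod Z I) X) (kprod Z X) _
    (fun p => (p.1.1, p.2)) _ _ cE).
  apply: kpair_continuous => //; last exact: ksnd_continuous.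
  exact: (continuousT_comp c1 (@kfst_continuous _ _)).
have chp (p : kprod Z I) : continuous (fun x => h (p, x)).
  apply: (@continuousT_comp X (kprod (kprod Z I) X) G (fun x => (p, x)) h) => //.
  apply: kpair_continuous; first exact: (space_cg X).2.
    exact: cst_continuous.
  by move=> x; exact: cvg_id.
pose K (p : kprod Z I) : map_space X G := (mkcts (chp p) : continuousType X G).
have cK : continuous K by apply: map_space_curry => //; exact: kprod_k_space.
have K0 z : K (z, zero) = set_val (F z : set_type _).
  by apply: mapof_inj => x; rewrite [RHS]Ff -H0.
(* At time zero [K] is [F z], which lies in the component; running the homotopy up to time [p.2],
   with time rescaled by that factor, gives a path to [K p]. *)
have Kc p : null_component (K p).
  have : null_component (K (p.1, zero)) by rewrite K0; exact: set_valP.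
  move=> /path_component_trans; apply.
  apply/path_componentP.
  exists (fun s => K (p.1, clamp (set_val p.2 * set_val s + 0))).
  split.
  - apply: (@continuousT_comp I (kprod Z I) _
      (fun s => (p.1, clamp (set_val p.2 * set_val s + 0))) K) => //.
    apply: kpair_continuous; first exact: unit_interval_k_space.
      exact: cst_continuous.
    exact: affine_clamp_continuous.
  - by rewrite clamp_le0 // mulr0 addr0.
  - rewrite mulr1 addr0 (_ : clamp (set_val p.2) = p.2) -?surjective_pairing //.
    apply: val_inj => /=; have := set_valP p.2.
    by rewrite /= in_itv /= => /andP[t0 t1]; rewrite min_r // max_r.
exists (fun p => exist _ (K p) (mem_set (Kc p)) : M); split.
- by apply: map_component_curry => //; exact: kprod_k_space.
- by move=> z; apply: ev_inj => x; rewrite Ff -H0.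
- by move=> z; apply: ev_inj => x; rewrite Fg -H1.
Qed.

End MapComponentTheory.

(** * Comparison of the commutator maps of [G] and of the function space *)

Lemma phi_continuous (T : topologicalType) (mul : T -> T -> T) (nu : T -> T) n :
  k_space T -> continuous (fun p : kprod T T => mul p.1 p.2) -> continuous nu ->
  continuous (@phi T mul nu n).
Proof.
move=> kT cmul cnu.
have cM (K : topologicalType) (f g : K -> T) : k_space K -> continuous f ->
    continuous g -> continuous (fun k => mul (f k) (g k)).
  by move=> kK cf cg; exact: (continuousT_comp (kpair_continuous kK cf cg) cmul).
elim: n => [x|n IHn] /=; first exact: cvg_id.
have kD : k_space (kprod (kpow T n) T) := @kprod_k_space _ _.
have c1 := continuousT_comp (@kfst_continuous (kpow T n) T) IHn.
have c2 := @ksnd_continuous (kpow T n) T.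
apply: (cM _ _ _ kD); apply: (cM _ _ _ kD) => //.
  exact: (continuousT_comp c1 cnu).
exact: (continuousT_comp c2 cnu).
Qed.

Section HnilMapComponent.
Variables (R : realType) (X : based_space R) (G : hspace R).
Notation e := (basepoint G).
Notation M := (map_component X G).
Notation "f ~~h g" := (homotopic R f g) (at level 70).
Notation mulM := (@component_mul R X G).
Notation mulG := (@hmul R G).

Lemma component_mul_continuous : continuous (fun p : kprod M M => mulM p.1 p.2).
Proof.
apply: map_component_curry; first exact: kprod_k_space.
exact: (continuousT_comp (@kmap_ev_continuous R X G 1) (@hmul_continuous R G)).
Qed.

Hypothesis pathG : forall y, path_component R e y.

(** A path from the identity to [y] gives a path of constant maps, so every constant map lies in the
    component; continuity holds because the adjoint is the first projection. *)
Lemma ex_constant_embedding :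
  exists2 c : G -> M, continuous c & forall y x, ev (c y) x = y.
Proof.
have cM (y : G) : @null_component R X G (const_map X y).
  exact: (path_component_image (@const_map_continuous R X G) (pathG y)).
exists (fun y => exist _ (const_map X y) (mem_set (cM y)) : M) => //.
apply: map_component_curry; first exact: (space_cg G).2.
exact: kfst_continuous.
Qed.

(** As [k] may move the identity, postcomposition sends the component into that of the constant map
    at [k e], which is the same one since [G] is path-connected. *)
Lemma ex_postcomposition (k : G -> G) : continuous k ->
  exists2 K : M -> M, continuous K & forall f x, ev (K f) x = k (ev f x).
Proof.
move=> ck.
have ckf (f : map_space X G) : continuous (k \o mapof f).
  by apply: continuousT_comp ck; exact: mapof_continuous.
pose K (f : map_space X G) : map_space X G := (mkcts (ckf f) : continuousType X G).
have cK : continuous K.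
  apply: map_space_curry; first exact: kify_k_space.
  have cid : continuous (id : map_space X G -> map_space X G).
    by move=> f; exact: cvg_id.
  exact: (continuousT_comp (map_space_uncurry (space_cg X).1 cid) ck).
have KM (f : M) : @null_component R X G (K (set_val (f : set_type _))).
  apply: (@path_component_trans R _ _ (const_map X (k e))).
    exact: (path_component_image (@const_map_continuous R X G) (pathG _)).
  have -> : const_map X (k e) = K (const_map X e) by exact: mapof_inj.
  exact: (path_component_image cK (set_valP f)).
exists (fun f => exist _ (K (set_val (f : set_type _))) (mem_set (KM f)) : M) => //.
apply: map_component_curry; first exact: map_component_k_space.
exact: (continuousT_comp (@ev_uncurry_continuous R X G) ck).
Qed.

Lemma phi_null_homotopic_map_component n :
  phi_null_homotopic R mulG n -> phi_null_homotopic R mulM n.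
Proof.
move=> [nu [hA [cnu [b1 nul] [b2 nur]] [b0 phi0]]].
have [c cc cE] := ex_constant_embedding.
have [N cN NE] := ex_postcomposition cnu.
exists N; split.
(* Powers are indexed from zero: 2 is the threefold power carrying associativity, and 0 below is [M]
   itself. *)
- exact: (homotopic_map_component (@kmap_ev_continuous R X G 2) hA).
- split=> //.
  + exists (c b1).
    apply: (homotopic_map_component (@kmap_ev_continuous R X G 0) nul) => f x /=.
      by rewrite ev_mul NE.
    by rewrite cE.
  + exists (c b2).
    apply: (homotopic_map_component (@kmap_ev_continuous R X G 0) nur) => f x /=.
      by rewrite ev_mul NE.
    by rewrite cE.
- exists (c b0).
  apply: (homotopic_map_component (@kmap_ev_continuous R X G n) phi0) => f x /=.
    by rewrite (phi_kmap _ (mulB := mulG) (nuB := nu) (r := fun f : M => ev f x)).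
  by rewrite cE.
Qed.

Lemma phi_null_homotopic_of_map_component n :
  homotopy_associative R mulG ->
  phi_null_homotopic R mulM n -> phi_null_homotopic R mulG n.
Proof.
move=> hA [N [_ [cN [f1 Nl] [f2 Nr]] [f0 phi0]]].
have [c cc cE] := ex_constant_embedding.
pose r (f : M) := ev f (basepoint X).
have cr : continuous r by exact: ev_continuous.
pose nu := r \o N \o c.
have cnu : continuous nu.
  by apply: continuousT_comp => //; apply: continuousT_comp.
have nul : (fun y => mulG (nu y) y) ~~h (fun=> r f1).
  have := homotopic_precomp cc (homotopic_postcomp cr Nl).
  congr (_ ~~h _); apply/funext => y.
  by rewrite /= /r ev_mul cE.
have nur : (fun y => mulG y (nu y)) ~~h (fun=> r f2).
  have := homotopic_precomp cc (homotopic_postcomp cr Nr).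
  congr (_ ~~h _); apply/funext => y.
  by rewrite /= /r ev_mul cE.
exists nu; split=> //.
  by split => //; [exists (r f1)|exists (r f2)].
(* [nu \o r] is a left inverse of [r] by precomposing [nul] with [r], and [r \o N] a right inverse
   by postcomposing [Nr] with [r]. *)
have nu_r : nu \o r ~~h r \o N.
  apply: (homotopic_inverse_unique pathG (a := r)) => //.
  - exact: map_component_k_space.
  - exact: continuousT_comp.
  - exact: continuousT_comp.
  - by exists (r f1); exact: (homotopic_precomp cr nul).
  - by exists (r f2); exact: (homotopic_postcomp cr Nr).
have phi_r m : (fun p : kpow M m => phi mulG nu (kmap r p)) ~~h
    (fun p => r (phi mulM N p)).
  elim: m => [|m IHm] /=; first exact: homotopic_refl.
  have cphi := @phi_continuous M mulM N m (@map_component_k_space R X G)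
    component_mul_continuous cN.
  have c1 := @kfst_continuous (kpow M m) M.
  have c2 := @ksnd_continuous (kpow M m) M.
  have rB : (fun p : kprod (kpow M m) M => r p.2) ~~h (fun p => r p.2).
    exact: homotopic_refl (continuousT_comp c2 cr).
  have rA := homotopic_precomp c1 IHm.
  apply: homotopic_hmul; first exact: (homotopic_hmul rA rB).
  apply: homotopic_hmul; last exact: (homotopic_precomp c2 nu_r).
  (* The induction hypothesis under [nu] leads to [nu \o r] after [phi mulM N]; then [nu_r] turns
     [nu \o r] into [r \o N]. *)
  apply: homotopic_trans (homotopic_postcomp cnu rA) _.
  exact: (homotopic_precomp (continuousT_comp c1 cphi) nu_r).
exists (r f0).
have ck := kmap_continuous (n := n) cc.
(* Restricting to tuples of constant maps removes [kmap r], since [r] is a retraction of [c]. *)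
have := homotopic_precomp ck
  (homotopic_trans (phi_r n) (homotopic_postcomp cr phi0)).
congr (_ ~~h _); apply/funext => p.
by rewrite /= kmap_comp_id // => y; exact: cE.
Qed.

End HnilMapComponent.

(** * Equality of the homotopical nilpotencies *)

Lemma group_homotopy_associative (R : realType) (G : hspace R) :
  is_topological_group G -> homotopy_associative R (@hmul R G).
Proof.
move=> [_ [_ mulA _ _ _]]; rewrite /homotopy_associative.
under [X in homotopic R _ X]eq_fun do rewrite mulA.
apply: homotopic_refl.
have c1 := @kfst_continuous (kprod G G) G.
apply: hmul_comp_continuous; first exact: kprod_k_space.
  exact: (continuousT_comp c1 (@hmul_continuous R G)).
exact: ksnd_continuous.
Qed.

Theorem theorem4p10 (R : realType) (X : based_space R) (G : hspace R)
    (G_connected : connected [set: G])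
    (hXG : is_topological_group G \/
           [/\ compact [set: X], is_CW_complex R G &
               homotopy_associative R (@hmul R G)]) :
  Hnil R (@component_mul R X G) = Hnil R (@hmul R G).
Proof.
have [hA pathG] : homotopy_associative R (@hmul R G) /\
    forall y, path_component R (basepoint G) y.
  case: hXG => [grpG|[_ cwG hA]].
    split=> [|y]; first exact: group_homotopy_associative.
    by rewrite group_path_connected.
  by split=> // y; rewrite cw_path_connected.
(* [Hnil] depends only on this predicate of [n], so its equality covers the finite and infinite
   cases together. *)
suff E : phi_null_homotopic R (@component_mul R X G) =
         phi_null_homotopic R (@hmul R G) by rewrite /Hnil E.
apply/funext => n; apply/propext; split.
  exact: phi_null_homotopic_of_map_component.
exact: phi_null_homotopic_map_component.
Qed.
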